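(* Let $n$ be a positive integer. The map $\zeta$ (defined in the context) is a bijection from the set of pairs $(P,Q)$ of noncrossing free Dyck paths of length $2n$ onto the set of noncrossing partitions of $[2n+1]=\{1,2,\ldots,2n+1\}$ with exactly $n+1$ blocks.
   Context: **Paths.** A free Dyck path of length $2n$ is a lattice path from $(0,0)$ to $(2n,0)$ with up steps $U=(1,1)$ and down steps $D=(1,-1)$; it is represented as a sequence of $n$ letters $U$ and $n$ letters $D$. It is allowed to go below the $x$-axis. A pair of noncrossing free Dyck paths of length $2n$ is an ordered pair $(P,Q)$ of free Dyck paths of length $2n$ such that $P$ never goes below $Q$ (they may touch or share steps). **Set partitions.** The standard representation of a partition $R$ of $[m]=\{1,\ldots,m\}$ is the graph on $[m]$ in which each block $\{i_1<i_2<\cdots<i_k\}$ contributes the arcs $(i_1,i_2),(i_2,i_3),\ldots,(i_{k-1},i_k)$. The partition $R$ is noncrossing if its standard representation contains no two arcs $(i_1,j_1),(i_2,j_2)$ with $i_1<i_2<j_1<j_2$. **Vacillating tableaux.** A vacillating tableau of length $2m$ and empty shape is a sequence $(\lambda^0,\lambda^1,\ldots,\lambda^{2m})$ of integer partitions (Young diagrams) with $\lambda^0=\lambda^{2m}=\emptyset$, where $\lambda^{2i+1}$ is equal to $\lambda^{2i}$ or obtained from it by deleting a square, and $\lambda^{2i}$ is equal to $\lambda^{2i-1}$ or obtained from it by adding a square. **From vacillating tableaux to set partitions.** Given such a vacillating tableau, define recursively tableaux $T_0,T_1,\ldots,T_{2m}$, where $T_i$ is a standard Young tableau (on a suitable alphabet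 of distinct positive integers) of shape $\lambda^i$ and $T_0$ is empty: 1. If $\lambda^i=\lambda^{i-1}$, then $T_i=T_{i-1}$. 2. If $\lambda^i\supsetneq\lambda^{i-1}$, then $i=2k$ for some $k\in[m]$, and $T_i$ is obtained from $T_{i-1}$ by adding the entry $k$ in the square $\lambda^i\setminus\lambda^{i-1}$. 3. If $\lambda^i\subsetneq\lambda^{i-1}$, then $i=2k-1$ for some $k\in[m]$, and $T_i$ is the unique standard Young tableau (on a suitable alphabet) of shape $\lambda^i$ such that $T_{i-1}$ is obtained from $T_i$ by RSK row insertion of some element $j$. In this case record the arc $(j,k)$. The recorded arcs form the standard representation of a partition of $[m]$, which is the partition corresponding to the vacillating tableau. **The map $\zeta$.** Let $(P,Q)$ be a pair of noncrossing free Dyck paths of length $2n$, with $P=p_1p_2\cdots p_{2n}$ and $Q=q_1q_2\cdots q_{2n}$. Construct a sequence $(\lambda^0,\lambda^1,\ldots,\lambda^{4n+2})$ of shapes, each with at most one row, by setting $\lambda^0=\lambda^1=\lambda^{4n+2}=\emptyset$ and, for $1\le i\le 2n$: - if $(p_i,q_i)=(U,U)$, then $\lambda^{2i}$ is obtained from $\lambda^{2i-1}$ by adding one square and $\lambda^{2i+1}$ is obtained from $\lambda^{2i}$ by deleting one square; - if $(p_i,q_i)=(U,D)$, then $\lambda^{2i}$ is obtained from $\lambda^{2i-1}$ by adding one square and $\lambda^{2i+1}=\lambda^{2i}$; - if $(p_i,q_i)=(D,U)$, then $\lambda^{2i}=\lambda^{2i-1}$ and $\lambda^{2i+1}$ is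 obtained from $\lambda^{2i}$ by deleting one square; - if $(p_i,q_i)=(D,D)$, then $\lambda^{2i-1}=\lambda^{2i}=\lambda^{2i+1}$. Then $\zeta(P,Q)$ is the partition of $[2n+1]$ corresponding, by the procedure above with $m=2n+1$, to this vacillating tableau of length $4n+2$ and empty shape. *)

(* Defs.v *)
From mathcomp Require Import all_boot all_order all_algebra.
From mathcomp Require Import boolp classical_sets functions.

Set Implicit Arguments.
Unset Strict Implicit.
Unset Printing Implicit Defensive.

Import Order.TTheory GRing.Theory Num.Theory.

(* A path is the sequence of its steps. *)
Notation Up := true (only parsing).
Notation Down := false (only parsing).

Definition height (p : seq bool) (i : nat) : int :=
  (\sum_(s <- take i p) (if s is Up then 1 else -1))%R.

Definition free_dyck (n : nat) (p : (2 * n).-tuple bool) : bool :=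
  height p (2 * n) == 0%R.

Definition noncrossing_pairs (n : nat) :
    {set (2 * n).-tuple bool * (2 * n).-tuple bool} :=
  [set pq | [&& free_dyck pq.1, free_dyck pq.2 &
    [forall i : 'I_(2 * n).+1, (height pq.2 i <= height pq.1 i)%R]]].

(* [m] = {1, ..., m} is a subset of 'I_m.+1 = {0, ..., m}, so that elements   *)
(* keep their numerical value.                                                *)
Definition ground (m : nat) : {set 'I_m.+1} := [set i : 'I_m.+1 | 0 < i].

Definition std_rep (m : nat) (R : {set {set 'I_m.+1}}) :
    {set 'I_m.+1 * 'I_m.+1} :=
  [set a | [exists B in R, [&& a.1 \in B, a.2 \in B, a.1 < a.2 &
    [forall c in B, ~~ (a.1 < c < a.2)]]]].

Definition noncrossing (m : nat) (R : {set {set 'I_m.+1}}) : bool :=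
  [forall a in std_rep R, forall b in std_rep R,
    ~~ [&& a.1 < b.1, b.1 < a.2 & a.2 < b.2]].

Definition noncrossing_partitions (m b : nat) : {set {set {set 'I_m.+1}}} :=
  [set R | [&& finset.partition R (ground m), noncrossing R & #|R| == b]].

(* An integer partition is the sequence of its (positive) parts. *)
Definition intpart (la : seq nat) : bool := sorted geq la && (0 \notin la).

Definition diag_sub (la mu : seq nat) : bool :=
  all (fun r => nth 0 la r <= nth 0 mu r) (iota 0 (size la)).

Definition add_square (la mu : seq nat) : bool :=
  diag_sub la mu && (sumn mu == (sumn la).+1).

Definition vacillating (m : nat) (lam : seq (seq nat)) : bool :=
  let la := nth [::] lam in
  [&& size lam == (2 * m).+1, all intpart lam,
      la 0 == [::], la (2 * m) == [::] &
      all (fun i =>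
        ((la (2 * i).+1 == la (2 * i)) || add_square (la (2 * i).+1) (la (2 * i)))
        && ((la (2 * i).+2 == la (2 * i).+1)
            || add_square (la (2 * i).+1) (la (2 * i).+2)))
      (iota 0 m)].

(* A tableau is the sequence of its rows, from top to bottom. *)
Definition std_tableau (T : seq (seq nat)) : bool :=
  [&& intpart (shape T), all (sorted ltn) T,
      sorted (fun r s => all (fun xy => xy.1 < xy.2) (zip r s)) T,
      uniq (flatten T) & 0 \notin flatten T].

(* Inserts x in the row r; the second component is the bumped entry, if any. *)
Fixpoint row_bump (r : seq nat) (x : nat) : seq nat * option nat :=
  if r is y :: r' then
    if x < y then (x :: r', Some y)
    else let: (r'', b) := row_bump r' x in (y :: r'', b)
  else ([:: x], None).

Fixpoint row_insert (T : seq (seq nat)) (x : nat) : seq (seq nat) :=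
  if T is r :: T' then
    let: (r', b) := row_bump r x in
    r' :: (if b is Some y then row_insert T' y else T')
  else [:: [:: x]].

(* The standard tableau T' of shape mu and the integer j such that T is       *)
(* obtained by row insertion of j in T'.                                      *)
Definition uninsert (T : seq (seq nat)) (mu : seq nat) : seq (seq nat) * nat :=
  xget ([::], 0)
    [set Tj | [/\ std_tableau Tj.1, shape Tj.1 = mu
                & row_insert Tj.1 Tj.2 = T]]%classic.

(* Extends T to the shape mu by putting k in the squares of mu outside T. *)
Definition add_entry (k : nat) (T : seq (seq nat)) (mu : seq nat) :
    seq (seq nat) :=
  mkseq (fun r => let row := nth [::] T r in
                  row ++ nseq (nth 0 mu r - size row) k) (size mu).

Fixpoint vt_tableau (lam : seq (seq nat)) (i : nat) : seq (seq nat) :=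
  if i is i'.+1 then
    let T := vt_tableau lam i' in
    let la := nth [::] lam i' in
    let mu := nth [::] lam i in
    if mu == la then T
    else if diag_sub la mu then add_entry i./2 T mu
    else (uninsert T mu).1
  else [::].

Definition vt_arcs (m : nat) (lam : seq (seq nat)) : seq (nat * nat) :=
  let la := nth [::] lam in
  [seq ((uninsert (vt_tableau lam (2 * k - 2)) (la (2 * k - 1))).2, k)
     | k <- iota 1 m
     & (la (2 * k - 1) != la (2 * k - 2))
       && diag_sub (la (2 * k - 1)) (la (2 * k - 2))].

(* The value is set0, which is not a partition of [m] for m > 0, if lam is    *)
(* not a vacillating tableau or if its arcs do not represent a partition.     *)
Definition vt_partition (m : nat) (lam : seq (seq nat)) : {set {set 'I_m.+1}} :=
  xget finset.set0
    [set R | [/\ vacillating m lam, finset.partition R (ground m)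
               & [seq (val a.1, val a.2) | a in std_rep R] =i vt_arcs m lam]]%classic.

Definition one_row (k : nat) : seq nat := if k is 0 then [::] else [:: k].

(* The numbers of squares of the shapes of index 2i and 2i+1, for successive  *)
(* i, where k is the number of squares of the shape before them. For a        *)
(* noncrossing pair of paths, no square is ever deleted from an empty shape.  *)
Fixpoint zeta_sizes (k : nat) (w : seq (bool * bool)) : seq nat :=
  match w with
  | [::] => [::]
  | (Up, Up) :: w' => [:: k.+1, k & zeta_sizes k w']
  | (Up, Down) :: w' => [:: k.+1, k.+1 & zeta_sizes k.+1 w']
  | (Down, Up) :: w' => [:: k, k.-1 & zeta_sizes k.-1 w']
  | (Down, Down) :: w' => [:: k, k & zeta_sizes k w']
  end.

Definition zeta_shapes (p q : seq bool) : seq (seq nat) :=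
  [:: [::], [::] & rcons (map one_row (zeta_sizes 0 (zip p q))) [::]].

Definition zeta (n : nat) (pq : (2 * n).-tuple bool * (2 * n).-tuple bool) :
    {set {set 'I_(2 * n).+2}} :=
  vt_partition (2 * n).+1 (zeta_shapes pq.1 pq.2).

(* Main.v *)
Require Import Defs.
From mathcomp Require Import all_boot all_order all_algebra.
From mathcomp Require Import boolp classical_sets functions.
From mathcomp Require Import zify.

(* In a tableau with one row, undoing a row insertion removes the last entry, *)
(* so the tableaux of zeta (P, Q) form a stack: the step i pushes i if        *)
(* p_i = U, and then, if q_i = U, pops the last entry j and records the arc   *)
(* (j, i + 1). The stack never gets stuck because P stays above Q, and        *)
(* last-in-first-out makes the arcs noncrossing; there are n of them, hence   *)
(* n + 1 blocks. The letters are read off the left and right ends of the      *)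
(* arcs. Conversely, if p and q are the indicators of the left and right ends *)
(* of a noncrossing set of arcs, the stack consists at each time of the left  *)
(* ends of the pending arcs, and the entry popped is always the right one,    *)
(* since an entry above it would start a crossing arc.                        *)

Set Implicit Arguments.
Unset Strict Implicit.
Unset Printing Implicit Defensive.

(** * The stack of a pair of words *)

(** The size of the stack after [i] steps is half the vertical distance between P and Q. Hence P
    stays above Q exactly when no pop meets an empty stack, and the common end point of the paths
    means an empty final stack ([noncrossing_pairsP]). The tableaux of zeta are this stack read from
    bottom to top, so the recorded arcs are its pops ([vt_arcs_pops]).

    Arcs and partitions carry the same information: sets of increasing arcs with at most one arc
    into and one arc out of each point are exactly the standard representations, and each determines
    its partition ([std_rep_arc_partition], [arc_partition_std_rep]). Every block has exactly one
    point that closes no arc, so arcs and blocks together number [m] ([card_std_rep]). With [n] pops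
    on [2 * n + 1] points this leaves [n + 1] blocks.

    Injectivity reads the letters off the ends of the arcs ([arcs_letters]). Surjectivity replays
    the stack on the end indicators of a noncrossing partition and recovers its arcs
    ([noncrossing_pops]). *)

Section Stack.
Variables P Q : nat -> bool.

(** Letters are indexed from 0, so step [i] may push [i.+1] and then pop the left end of an arc
    closing at [i.+2]. The top of the stack is the head of the list. *)
Fixpoint stack (i : nat) : seq nat :=
  if i is i'.+1 then
    let s := if P i' then i :: stack i' else stack i' in
    if Q i' then behead s else s
  else [::].

Definition pushed (i : nat) : seq nat :=
  if P i then i.+1 :: stack i else stack i.

Lemma stackS i : stack i.+1 = if Q i then behead (pushed i) else pushed i.
Proof. by []. Qed.

Definition pops (N : nat) : seq (nat * nat) :=
  [seq (head 0 (pushed i), i.+2) | i <- iota 0 N & Q i].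

Lemma mem_pops N j k :
  (j, k) \in pops N <->
  exists i, [/\ i < N, Q i, j = head 0 (pushed i) & k = i.+2].
Proof.
split=> [/mapP[i]|[i [iN Qi -> ->]]].
  by rewrite mem_filter mem_iota => /andP[Qi iN] [-> ->]; exists i.
by apply/mapP; exists i => //; rewrite mem_filter Qi mem_iota.
Qed.

Lemma size_pops N : size (pops N) = count Q (iota 0 N).
Proof. by rewrite size_map size_filter. Qed.

Lemma pops_uniq N : uniq (pops N).
Proof.
rewrite map_inj_uniq ?filter_uniq ?iota_uniq //.
by move=> i i' [_ ->].
Qed.

Lemma stack_bounded i j : j \in stack i -> 0 < j <= i.
Proof.
elim: i j => // i IHi j; rewrite stackS.
suff Hp : j \in pushed i -> 0 < j <= i.+1.
  by case: (Q i) => // /mem_behead.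
rewrite /pushed; case: (P i); first by rewrite in_cons => /orP[/eqP->|/IHi]; lia.
by move/IHi; lia.
Qed.

Lemma pushed_bounded i j : j \in pushed i -> 0 < j <= i.+1.
Proof.
rewrite /pushed; case: (P i); first by rewrite in_cons => /orP[/eqP->|/stack_bounded]; lia.
by move/stack_bounded; lia.
Qed.

Lemma pushed_sorted i : sorted gtn (pushed i).
Proof.
have Hp k : sorted gtn (stack k) -> sorted gtn (pushed k).
  rewrite /pushed; case: (P k) => //= sk.
  rewrite path_sortedE; last by move=> a b c /= ba cb; exact: ltn_trans cb ba.
  by rewrite sk andbT; apply/allP => j /stack_bounded /=; lia.
apply: (Hp); elim: i => // i /Hp; rewrite stackS; case: (Q i) => //.
by case: (pushed i) => //= a l /path_sorted.
Qed.

Lemma pushed_consP i j l : pushed i = j :: l ->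
  j \notin l /\ (forall k, k \in l -> k < j).
Proof.
move=> E; have := pushed_sorted i; rewrite E /= path_sortedE; last first.
  by move=> a b c /= ba cb; exact: ltn_trans cb ba.
case/andP=> /allP lt_l _; split; last by move=> k /lt_l.
by apply/negP => /lt_l /=; rewrite ltnn.
Qed.

Definition never_stuck (N : nat) := forall i, i < N -> Q i -> pushed i != [::].

Lemma size_stack N : never_stuck N ->
  forall i, i <= N ->
  size (stack i) + count Q (iota 0 i) = count P (iota 0 i).
Proof.
move=> ns; elim=> // i IHi iN; rewrite stackS -addn1 !iotaD !count_cat /= !add0n !addn0.
have := IHi (ltnW iN); have := ns i iN; rewrite /pushed.
case: (P i) => /=; case: (Q i) => //=; try lia.
by move=> /(_ isT); case: (stack i) => //= a l _; lia.
Qed.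

(** By induction the stack before the last step has as many entries as the excess of pushes over
    pops; the inequality one step further says that this step still finds an entry to pop. *)
Lemma never_stuck_count N :
  (forall i, i <= N -> count Q (iota 0 i) <= count P (iota 0 i)) ->
  never_stuck N.
Proof.
elim: N => // N IHN le_QP; have nsN : never_stuck N.
  by apply: IHN => i iN; apply: le_QP; lia.
move=> i; rewrite ltnS leq_eqVlt => /orP[/eqP-> QN|]; last exact: nsN.
have := le_QP N.+1 (leqnn _); have := size_stack nsN (leqnn N).
rewrite -addn1 !iotaD !count_cat /= !add0n QN /pushed.
by case: (P N) => //; case: (stack N) => //=; lia.
Qed.

(** * Arcs recorded by a stack that never gets stuck *)

Section Sound.
Variable N : nat.
Hypothesis ns : never_stuck N.

Lemma pushed_pop i : i < N -> Q i ->
  pushed i = head 0 (pushed i) :: stack i.+1.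
Proof. by move=> iN Qi; have := ns iN Qi; rewrite stackS Qi; case: (pushed i). Qed.

Lemma mem_head_pushed i : i < N -> Q i -> head 0 (pushed i) \in pushed i.
Proof. by move=> iN Qi; rewrite [X in _ \in X](pushed_pop iN Qi) mem_head. Qed.

Lemma stack_opener i j : j \in stack i -> P j.-1.
Proof.
elim: i j => // i IHi j; rewrite stackS.
have Hp : j \in pushed i -> P j.-1.
  rewrite /pushed; case: ifP => [Pi|_]; last exact: IHi.
  by rewrite in_cons => /orP[/eqP->|/IHi].
by case: (Q i) => // /mem_behead.
Qed.

Lemma pops_opener j k : (j, k) \in pops N -> P j.-1.
Proof.
case/mem_pops=> i [iN Qi -> _]; have := mem_head_pushed iN Qi.
rewrite /pushed; case: ifP => [//|_]; exact: stack_opener.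
Qed.

Lemma opener_popped i : i <= N -> forall j, j < i -> P j ->
  j.+1 \in stack i \/ exists2 k, k <= i.+1 & (j.+1, k) \in pops N.
Proof.
elim: i => // i IHi iN j ji Pj.
have [jp|[k ki jk]] : j.+1 \in pushed i \/
    exists2 k, k <= i.+1 & (j.+1, k) \in pops N.
- move: ji; rewrite /pushed ltnS leq_eqVlt => /orP[/eqP<-|ji].
    by left; rewrite Pj mem_head.
  have [jp|] := IHi (ltnW iN) j ji Pj; last by right.
  by left; case: (P i); rewrite // in_cons jp orbT.
- case: (boolP (Q i)) => Qi; last by left; rewrite stackS (negPf Qi).
  move: jp; rewrite (pushed_pop iN Qi) in_cons => /orP[/eqP->|]; last by left.
  by right; exists i.+2 => //; apply/mem_pops; exists i.
- by right; exists k => //; lia.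
Qed.

Lemma pops_ltn j k : (j, k) \in pops N -> [/\ 0 < j, j < k & k <= N.+1].
Proof.
case/mem_pops=> i [iN Qi -> ->].
by have /pushed_bounded := mem_head_pushed iN Qi; split; lia.
Qed.

(** Last-in-first-out: what remains below a popped entry is smaller than it, and what is pushed
    later is at least [i.+2]. This yields both that an entry is popped only once and that arcs do
    not cross. *)
Lemma popped_stack i : i < N -> Q i -> forall i', i < i' -> i' <= N ->
  forall j, j \in stack i' ->
  j != head 0 (pushed i) /\ ~~ (head 0 (pushed i) < j < i.+2).
Proof.
move=> iN Qi; elim=> // i' IHi ii' i'N j.
move: ii'; rewrite ltnS leq_eqVlt => /orP[/eqP<-|ii'].
  have [ni lti] := pushed_consP (pushed_pop iN Qi) => js.
  by have := lti _ js; split; [lia | apply/negP; lia].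
have H : j \in pushed i' ->
    j != head 0 (pushed i) /\ ~~ (head 0 (pushed i) < j < i.+2).
  have /pushed_bounded lt_h := mem_head_pushed iN Qi.
  rewrite {1}/pushed; case: (P i') => [|js]; last by apply: IHi => //; lia.
  rewrite in_cons => /orP[/eqP->|js]; first by split; lia.
  by apply: IHi => //; lia.
by rewrite stackS; case: (Q i') => // /mem_behead.
Qed.

Lemma popped_pushed i i' : i < i' -> i' < N -> Q i ->
  forall j, j \in pushed i' ->
  j != head 0 (pushed i) /\ ~~ (head 0 (pushed i) < j < i.+2).
Proof.
move=> ii' i'N Qi j; have iN := ltn_trans ii' i'N.
have /pushed_bounded lt_h := mem_head_pushed iN Qi.
rewrite {1}/pushed; case: (P i') => [|js]; last first.
  by apply: (popped_stack iN Qi ii' _ js); lia.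
rewrite in_cons => /orP[/eqP->|js]; first by split; lia.
by apply: (popped_stack iN Qi ii' _ js); lia.
Qed.

Lemma pops_fun j k k' : (j, k) \in pops N -> (j, k') \in pops N -> k = k'.
Proof.
case/mem_pops=> i [iN Qi -> ->] /mem_pops[i' [i'N Qi' e ->]].
case: (ltngtP i i') => [ii'|ii'|->] //.
  have [] := popped_pushed ii' i'N Qi (mem_head_pushed i'N Qi').
  by rewrite e eqxx.
have [] := popped_pushed ii' iN Qi' (mem_head_pushed iN Qi).
by rewrite e eqxx.
Qed.

Lemma pops_inj j j' k : (j, k) \in pops N -> (j', k) \in pops N -> j = j'.
Proof. by case/mem_pops=> i [iN Qi -> ->] /mem_pops[i' [i'N Qi' -> [->]]]. Qed.

Lemma pops_noncrossing j k j' k' : (j, k) \in pops N -> (j', k') \in pops N ->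
  ~~ [&& j < j', j' < k & k < k'].
Proof.
case/mem_pops=> i [iN Qi -> ->] /mem_pops[i' [i'N Qi' -> ->]].
case: (ltnP i i') => ii'; last by apply/negP; lia.
have [_] := popped_pushed ii' i'N Qi (mem_head_pushed i'N Qi').
by apply: contra => /and3P[-> ->].
Qed.

End Sound.

(** * Recovering noncrossing arcs from the indicators of their ends *)

Section Complete.
Variables (N : nat) (e : nat -> nat -> Prop).
Hypothesis e_bound : forall j k, e j k -> [/\ 0 < j, j < k & k <= N.+1].
Hypothesis e_inj : forall j j' k, e j k -> e j' k -> j = j'.
Hypothesis e_fun : forall j k k', e j k -> e j k' -> k = k'.
Hypothesis e_noncrossing : forall j k j' k', e j k -> e j' k' ->
  ~~ [&& j < j', j' < k & k < k'].
Hypothesis e_P : forall i, i < N -> P i <-> exists k, e i.+1 k.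
Hypothesis e_Q : forall i, i < N -> Q i <-> exists j, e j i.+2.

Lemma mem_pushed_step i : i < N ->
  (forall j, j \in stack i <-> j <= i /\ exists2 k, i.+1 < k & e j k) ->
  forall j, j \in pushed i <-> j <= i.+1 /\ exists2 k, i.+1 < k & e j k.
Proof.
move=> iN Hi j; have := e_P iN; rewrite /pushed.
case: (P i) => [[/(_ isT)[k ek] _]|[_ Pi]].
  rewrite in_cons; split=> [/orP[/eqP->|/Hi[ji jk]]|[]].
  - by split=> //; exists k => //; case: (e_bound ek).
  - by split=> //; lia.
  - rewrite leq_eqVlt => /orP[->//|ji] jk; rewrite (_ : j \in stack i) ?orbT //.
    exact/Hi.
split=> [/Hi[ji jk]|[]]; first by split=> //; lia.
rewrite leq_eqVlt => /orP[/eqP->[k _ ek]|ji jk]; last exact/Hi.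
by have := Pi (ex_intro _ k ek).
Qed.

(** An entry above [j] would be a larger left end whose arc is still pending; that arc would have to
    close after [i.+2] and so cross the arc from [j]. *)
Lemma head_pushed_step i j : i < N ->
  (forall j, j \in pushed i <-> j <= i.+1 /\ exists2 k, i.+1 < k & e j k) ->
  e j i.+2 -> exists l, pushed i = j :: l.
Proof.
move=> iN Hi eji; have [_ ji _] := e_bound eji.
have : j \in pushed i by apply/Hi; split=> //; exists i.+2.
case E: (pushed i) => [//|h l]; have [_ lt_l] := pushed_consP E.
rewrite in_cons => /orP[/eqP->|/lt_l jh]; first by exists l.
have : h \in pushed i by rewrite E mem_head.
case/Hi=> hi [k ik ehk]; have := e_noncrossing eji ehk.
have : k != i.+2 by apply/eqP => ek; have := e_inj eji; rewrite -ek => /(_ _ ehk); lia.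
by move=> ? /negP[]; lia.
Qed.

(** The invariant of the replay: the stack holds the left ends of the pending arcs. The bound is
    [i.+1] because the first [i] steps handle the right ends up to [i.+1]. *)
Lemma mem_stack i : i <= N ->
  forall j, j \in stack i <-> j <= i /\ exists2 k, i.+1 < k & e j k.
Proof.
elim: i => [_ j|i IHi iN j].
  split=> // -[]; rewrite leqn0 => /eqP-> [k _ /e_bound[]]; lia.
have Hp := mem_pushed_step iN (IHi (ltnW iN)).
have := e_Q iN; rewrite stackS; case: (Q i) => [[/(_ isT)[h eh] _]|[_ Qi]].
  have [l El] := head_pushed_step iN Hp eh; have [hl _] := pushed_consP El.
  rewrite El /=; split=> [jl|[ji [k ik ek]]].
    have : j \in pushed i by rewrite El in_cons jl orbT.
    case/Hp=> ji [k ik ek]; split=> //; exists k => //.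
    suff : k != i.+2 by lia.
    apply/eqP => ei; move: ek hl; rewrite ei => /(e_inj eh) ->.
    by rewrite jl.
  have : j \in pushed i by apply/Hp; split=> //; exists k => //; lia.
  rewrite El in_cons => /orP[/eqP ej|//].
  by move: ek; rewrite ej => /(e_fun eh); lia.
split=> [/Hp[ji [k ik ek]]|[ji [k ik ek]]].
  split=> //; exists k => //; suff : k != i.+2 by lia.
  by apply/eqP => ei; rewrite ei in ek; have := Qi (ex_intro _ j ek).
by apply/Hp; split=> //; exists k => //; lia.
Qed.

Lemma head_pushed i j : i < N -> e j i.+2 -> exists l, pushed i = j :: l.
Proof.
move=> iN; apply: head_pushed_step => //.
by apply: mem_pushed_step => //; apply: mem_stack; exact: ltnW.
Qed.

Lemma noncrossing_never_stuck : never_stuck N.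
Proof.
by move=> i iN /(e_Q iN)[j /(head_pushed iN)[l ->]].
Qed.

Lemma noncrossing_pops j k : (j, k) \in pops N <-> e j k.
Proof.
split=> [/mem_pops[i [iN Qi -> ->]]|ejk].
  by have /(e_Q iN)[h eh] := Qi; have [l ->] := head_pushed iN eh.
have [j0 jk kN] := e_bound ejk.
have Ek : k = k.-2.+2 by lia.
have iN : k.-2 < N by lia.
rewrite Ek in ejk; apply/mem_pops; exists k.-2; split=> //.
  by apply/e_Q => //; exists j.
by have [l ->] := head_pushed iN ejk.
Qed.

Lemma noncrossing_stack_end : stack N = [::].
Proof.
case E: (stack N) => [//|j l].
have /mem_stack-/(_ (leqnn N))[_ [k Nk /e_bound[_ _]]] : j \in stack N.
  by rewrite E mem_head.
by lia.
Qed.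

End Complete.
End Stack.

(** * Tableaux with one row *)

Definition one_row_tableau (s : seq nat) : seq (seq nat) :=
  if s is [::] then [::] else [:: s].

Lemma shape_one_row_tableau s : shape (one_row_tableau s) = one_row (size s).
Proof. by case: s. Qed.

Lemma std_one_row_tableau s :
  sorted ltn s -> 0 \notin s -> std_tableau (one_row_tableau s).
Proof.
rewrite /std_tableau shape_one_row_tableau; case: s => [//|x s] lt_s s0.
rewrite /= cats0 s0 -[path _ _ _]/(sorted ltn (x :: s)) lt_s /= andbT.
exact: (sorted_uniq ltn_trans ltnn (s := x :: s)).
Qed.

Lemma row_bump_max s x : all (gtn x) s -> row_bump s x = (rcons s x, None).
Proof.
elim: s => //= y s IHs /andP[yx /IHs->].
by rewrite ltnNge (ltnW yx).
Qed.

Lemma row_bump_size s x :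
  size (row_bump s x).1 = size s + ((row_bump s x).2 == None).
Proof.
elim: s => //= y s IHs; case: ifP => [_|_]; first by rewrite addn0.
by move: IHs; case: (row_bump s x) => r b /= ->.
Qed.

Lemma row_bump_None s x :
  (row_bump s x).2 = None -> (row_bump s x).1 = rcons s x.
Proof.
elim: s => //= y s IHs; case: ifP => //.
by case: (row_bump s x) IHs => r b /= H _ /H ->.
Qed.

(** Appending a maximum is a row insertion, and it is the only one possible: the row gets longer
    only if nothing is bumped, and then the inserted entry lands at its end. Uniqueness is what
    fixes the value chosen by [xget]. *)
Lemma uninsert_one_row s x : sorted ltn (rcons s x) -> 0 \notin s ->
  uninsert (one_row_tableau (rcons s x)) (one_row (size s)) =
  (one_row_tableau s, x).
Proof.
move=> lt_sx s0.
move: lt_sx; rewrite (sorted_pairwise ltn_trans) pairwise_rcons.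
rewrite -(sorted_pairwise ltn_trans) => /andP[ltx lt_s].
apply: xget_unique => /=.
  split; [exact: std_one_row_tableau| exact: shape_one_row_tableau|].
  by case: s ltx {s0 lt_s} => [//|y s] ltx; rewrite [LHS]/=
    -[if _ then _ else _]/(row_bump (y :: s) x) row_bump_max.
case=> T j /= [_ shT].
case: s shT {s0 lt_s ltx} => [|y s]; first by case: T => //= _ [->].
case: T => [//|r [|//]] /= [sz_r].
case E: (row_bump r j) => [r' b] [er' eb].
have := row_bump_size r j; rewrite E /= er' /= size_rcons sz_r => /esym /eqP.
have := @row_bump_None r j; rewrite E /=.
case: b E eb => [b|] E eb; first by rewrite eqn_leq addn0 ltnn.
by move=> /(_ erefl); rewrite er' -rcons_cons => /rcons_inj[-> ->].
Qed.

(** * The shapes and tableaux of zeta *)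

Section Shapes.
Variables p q : seq bool.
Hypothesis size_pq : size p = size q.
Local Notation P := (nth false p).
Local Notation Q := (nth false q).
Local Notation N := (size p).
Local Notation lam := (zeta_shapes p q).

(** The starting point [i] is general so that induction on [d] can move along the word. The
    truncated predecessor in [zeta_sizes] agrees with [behead] on the stack. *)
Lemma zeta_sizes_stack i d : i + d < N ->
  nth 0 (zeta_sizes (size (stack P Q i)) (drop i (zip p q))) (2 * d) =
    size (pushed P Q (i + d)) /\
  nth 0 (zeta_sizes (size (stack P Q i)) (drop i (zip p q))) (2 * d).+1 =
    size (stack P Q (i + d).+1).
Proof.
have szz : size (zip p q) = N by rewrite size_zip -size_pq minnn.
elim: d i => [|d IHd] i lt_idN.
  rewrite (drop_nth (false, false)) ?szz; last by lia.
  rewrite nth_zip // addn0 stackS /pushed.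
  by case: (P i); case: (Q i) => //=; rewrite size_behead.
rewrite (drop_nth (false, false)) ?szz; last by lia.
have := IHd i.+1; rewrite addSnnS => /(_ lt_idN).
rewrite mulnS nth_zip // stackS /pushed.
by case: (P i); case: (Q i) => //=; rewrite size_behead.
Qed.

Lemma size_zeta_sizes k w : size (zeta_sizes k w) = 2 * size w.
Proof. by elim: w k => // [[[] []] w IHw] k /=; rewrite IHw; lia. Qed.

Lemma size_zeta_shapes : size lam = (2 * N.+1).+1.
Proof.
rewrite /= size_rcons size_map size_zeta_sizes size_zip -size_pq minnn; lia.
Qed.

Lemma shape_push i : i < N ->
  nth [::] lam (2 * i.+1) = one_row (size (pushed P Q i)).
Proof.
move=> iN; rewrite mulnS /= nth_rcons size_map size_zeta_sizes.
rewrite size_zip -size_pq minnn ltn_pmul2l // iN.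
have [<- _] := @zeta_sizes_stack 0 i iN; rewrite (nth_map 0) ?drop0 //.
by rewrite size_zeta_sizes size_zip -size_pq minnn ltn_pmul2l.
Qed.

Lemma shape_pop i : i <= N ->
  nth [::] lam (2 * i).+1 = one_row (size (stack P Q i)).
Proof.
case: i => // i iN; rewrite mulnS /= nth_rcons size_map size_zeta_sizes.
rewrite size_zip -size_pq minnn (_ : (2 * i).+1 < 2 * N); last by lia.
have [_] := @zeta_sizes_stack 0 i iN; rewrite add0n => <-.
rewrite (nth_map 0) ?drop0 //.
by rewrite size_zeta_sizes size_zip -size_pq minnn; lia.
Qed.

Lemma shape_last : nth [::] lam (2 * N.+1) = [::].
Proof.
rewrite mulnS /= nth_rcons size_map size_zeta_sizes.
by rewrite size_zip -size_pq minnn ltnn eqxx.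
Qed.

Lemma one_row_inj : injective one_row.
Proof. by case=> [|k] [|k'] //= [->]. Qed.

Lemma one_row_eq k k' : (one_row k == one_row k') = (k == k').
Proof. exact: inj_eq one_row_inj k k'. Qed.

Lemma diag_sub_one_row k k' : diag_sub (one_row k) (one_row k') = (k <= k').
Proof. by case: k => [|k]; case: k' => [|k'] //=; rewrite /diag_sub /= andbT. Qed.

Lemma add_square_one_row k : add_square (one_row k) (one_row k.+1).
Proof.
rewrite /add_square diag_sub_one_row leqnSn /= addn0.
by case: k => //= k; rewrite addn0.
Qed.

Lemma intpart_one_row k : intpart (one_row k).
Proof. by case: k. Qed.

Hypothesis ns : never_stuck P Q N.

Lemma zeta_vacillating : stack P Q N = [::] -> vacillating N.+1 lam.
Proof.
move=> sN; apply/and5P; split.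
- by rewrite size_zeta_shapes.
- by rewrite /= all_rcons /= all_map; apply/allP => k _ /=; exact: intpart_one_row.
- by [].
- by rewrite shape_last.
apply/allP => i; rewrite mem_iota add0n ltnS => /andP[_ iN]; apply/andP; split.
  rewrite shape_pop //; case: i iN => // i iN; rewrite shape_push // stackS.
  case: ifP => [Qi|]; last by rewrite eqxx.
  by have := ns iN Qi; case: (pushed P Q i) => //= a l _; rewrite add_square_one_row orbT.
rewrite shape_pop // -[(2 * i).+2]/(2 + 2 * i) -mulnS.
(* The last shape is appended as [[::]] whatever the paths are, so at [i = N] it must be matched
   with the final stack. *)
move: iN; rewrite leq_eqVlt => /orP[/eqP->|iN]; first by rewrite shape_last sN.
rewrite shape_push // /pushed; case: ifP => _; last by rewrite eqxx.
by rewrite /= add_square_one_row orbT.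
Qed.

Lemma rev_pushed_sorted i : sorted ltn (rev (pushed P Q i)).
Proof. by rewrite rev_sorted; exact: pushed_sorted. Qed.

Lemma rev_pushed_pos i : 0 \notin rev (pushed P Q i).
Proof. by rewrite mem_rev; apply/negP => /pushed_bounded. Qed.

(** Reversal turns the decreasing stack into an increasing row, whose last entry is the top of the
    stack. *)
Lemma uninsert_pushed i : i < N -> Q i ->
  uninsert (one_row_tableau (rev (pushed P Q i)))
           (one_row (size (stack P Q i.+1))) =
  (one_row_tableau (rev (stack P Q i.+1)), head 0 (pushed P Q i)).
Proof.
move=> iN Qi; have := rev_pushed_sorted i; have := rev_pushed_pos i.
rewrite (pushed_pop ns iN Qi) rev_cons mem_rcons inE negb_or -(size_rev (stack _ _ _)).
by case/andP=> _ s0 lts; exact: uninsert_one_row.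
Qed.

Lemma vt_tableauS i : vt_tableau lam i.+1 =
  if nth [::] lam i.+1 == nth [::] lam i then vt_tableau lam i
  else if diag_sub (nth [::] lam i) (nth [::] lam i.+1)
       then add_entry i.+1./2 (vt_tableau lam i) (nth [::] lam i.+1)
       else (uninsert (vt_tableau lam i) (nth [::] lam i.+1)).1.
Proof. by []. Qed.

Lemma tableau_push i : i < N ->
  vt_tableau lam (2 * i).+1 = one_row_tableau (rev (stack P Q i)) ->
  vt_tableau lam (2 * i.+1) = one_row_tableau (rev (pushed P Q i)).
Proof.
move=> iN Ti; rewrite mulnS -[2 + 2 * i]/((2 * i).+2).
rewrite vt_tableauS Ti -[(2 * i).+2]/(2 + 2 * i) -mulnS.
rewrite shape_push ?shape_pop ?one_row_eq ?diag_sub_one_row //; last exact: ltnW.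
rewrite mul2n doubleK /pushed; case: (P i); last by rewrite eqxx.
rewrite /= gtn_eqF // leqnSn rev_cons -[size (stack _ _ _)]size_rev.
move: (rev _) => s; rewrite /add_entry /mkseq /=.
by case: s => [|x s] //=; rewrite subSnn -cats1.
Qed.

Lemma tableau_pop i : i < N ->
  vt_tableau lam (2 * i.+1) = one_row_tableau (rev (pushed P Q i)) ->
  vt_tableau lam (2 * i.+1).+1 = one_row_tableau (rev (stack P Q i.+1)).
Proof.
move=> iN Ti; rewrite vt_tableauS Ti shape_push // shape_pop //.
rewrite one_row_eq diag_sub_one_row.
case: (boolP (Q i)) => Qi; last by rewrite stackS (negPf Qi) eqxx.
have := uninsert_pushed iN Qi; have := congr1 size (pushed_pop ns iN Qi) => /= ->.
by rewrite ltn_eqF // ltnn => ->.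
Qed.

Lemma tableau_stack i : i <= N ->
  vt_tableau lam (2 * i).+1 = one_row_tableau (rev (stack P Q i)).
Proof.
elim: i => [|i IHi] iN; first by [].
by apply: tableau_pop => //; apply: tableau_push => //; apply: IHi; exact: ltnW.
Qed.

Lemma vt_arcs_pops : vt_arcs N.+1 lam = pops P Q N.
Proof.
(* The index [k = 1] records nothing, the first two shapes being empty; the others are [k = 2 + i]
   for step [i]. *)
rewrite /vt_arcs /pops -[iota 1 N.+1]/(1 :: iota 2 N) (iotaDl 2 0) /=.
rewrite !filter_map -map_comp.
have Hf : {in iota 0 N, Q =1 preim (addn 2) (fun k =>
    (nth [::] lam (2 * k - 1) != nth [::] lam (2 * k - 2)) &&
    diag_sub (nth [::] lam (2 * k - 1)) (nth [::] lam (2 * k - 2)))}.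
  move=> i; rewrite mem_iota => /andP[_ iN].
  rewrite -[RHS]/((nth [::] lam (2 * (2 + i) - 1) != nth [::] lam (2 * (2 + i) - 2))
    && diag_sub (nth [::] lam (2 * (2 + i) - 1)) (nth [::] lam (2 * (2 + i) - 2))).
  rewrite (_ : 2 * (2 + i) - 1 = (2 * i.+1).+1); last by lia.
  rewrite (_ : 2 * (2 + i) - 2 = 2 * i.+1); last by lia.
  rewrite shape_push // shape_pop // one_row_eq diag_sub_one_row.
  case: (boolP (Q i)) => Qi; last by rewrite stackS (negPf Qi) eqxx.
  by rewrite (congr1 size (pushed_pop ns iN Qi)) /= ltn_eqF // leqnSn.
rewrite -(eq_in_filter Hf); apply/eq_in_map => i.
rewrite mem_filter mem_iota => /and3P[Qi _ iN]; rewrite [LHS]/comp.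
rewrite (_ : 2 * (2 + i) - 1 = (2 * i.+1).+1); last by lia.
rewrite (_ : 2 * (2 + i) - 2 = 2 * i.+1); last by lia.
rewrite shape_pop // (tableau_push iN (tableau_stack (ltnW iN))).
by rewrite uninsert_pushed.
Qed.

End Shapes.

(** * Partitions and their arcs *)

Section Arcs.
Variable m : nat.
Implicit Types (E : {set 'I_m.+1 * 'I_m.+1}) (R : {set {set 'I_m.+1}}).
Implicit Types (B : {set 'I_m.+1}) (x y z : 'I_m.+1).

Definition arc_diagram E :=
  [/\ forall x y, (x, y) \in E -> 0 < x < y,
      forall x x' y, (x, y) \in E -> (x', y) \in E -> x = x'
    & forall x y y', (x, y) \in E -> (x, y') \in E -> y = y'].

Lemma std_repP R x y : reflect
  (exists2 B, B \in R &
    [/\ x \in B, y \in B, x < y & forall c, c \in B -> x < c -> y <= c])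
  ((x, y) \in std_rep R).
Proof.
rewrite finset.in_set; apply: (iffP existsP) => [[B /and5P[BR xB yB xy /forall_inP H]]|].
  exists B => //; split=> // c cB xc; rewrite leqNgt.
  by apply: contra (H _ cB) => cy; rewrite xc.
case=> B BR [xB yB xy H]; exists B; apply/and5P; split=> //.
by apply/forall_inP => c cB; apply/negP => /andP[/(H _ cB)]; rewrite leqNgt => /negP.
Qed.

(** * From arc diagrams to partitions *)

Section Root.
Variable E : {set 'I_m.+1 * 'I_m.+1}.
Hypothesis Egood : arc_diagram E.

Definition parent x := if [pick z | (z, x) \in E] is Some z then z else x.
(** The minimum of the block of [x]: each proper step to a parent decreases the value, which is at
    most [m], so [m] steps reach a fixed point. *)
Definition root x := iter m parent x.

Lemma parent_arc x y : (x, y) \in E -> parent y = x.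
Proof.
move=> xy; rewrite /parent; case: pickP => [z zy|/(_ x)]; last by rewrite xy.
by have [_ inj _] := Egood; exact: inj zy xy.
Qed.

Lemma parentP x :
  parent x = x /\ (forall z, (z, x) \notin E) \/ (parent x, x) \in E.
Proof.
rewrite /parent; case: pickP => [z|H]; first by right.
by left; split=> // z; rewrite H.
Qed.

Lemma parent_root x : parent (root x) = root x.
Proof.
have [lt_arc _ _] := Egood.
suff H k y : y <= k -> parent (iter k parent y) = iter k parent y.
  by apply: H; rewrite -ltnS.
elim: k y => [|k IHk] y yk.
  by case: (parentP y) => [[]//|/lt_arc]; lia.
case: (parentP y) => [[fix_y _]|/lt_arc ltp].
  by have -> : iter k.+1 parent y = y; last by []; apply: iter_fix.
by rewrite iterSr; apply: IHk; lia.
Qed.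

Lemma root_parent x : root (parent x) = root x.
Proof. by rewrite /root -iterSr iterS parent_root. Qed.

Lemma root_arc x y : (x, y) \in E -> root x = root y.
Proof. by move=> xy; rewrite -(root_parent y) (parent_arc xy). Qed.

Lemma root_noarc x z : (z, root x) \notin E.
Proof.
case: (parentP (root x)) => [[_ ->//]|]; rewrite parent_root.
by have [lt_arc _ _] := Egood => /lt_arc; rewrite ltnn andbF.
Qed.

Lemma root_le x : root x <= x.
Proof.
have H k y : iter k parent y <= y.
  elim: k => //= k IHk; case: (parentP (iter k parent y)) => [[-> _]//|].
  by have [lt_arc _ _] := Egood => /lt_arc; lia.
exact: H.
Qed.

Lemma root_gt0 x : 0 < x -> 0 < root x.
Proof.
move=> x0; suff H k : 0 < iter k parent x by exact: H.
elim: k => //= k IHk; case: (parentP (iter k parent x)) => [[-> _]//|].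
by have [lt_arc _ _] := Egood => /lt_arc /andP[].
Qed.

(** Strong induction on [x + y], replacing [y] by its parent. If [y] has none, it is the common
    root, which is at most [x]. If the parent is below [x], induction gives an arc from it ending at
    most at [x], against the uniqueness of its arc to [y]. *)
Lemma next_arc x y : root x = root y -> x < y ->
  exists2 z : 'I_m.+1, z <= y & (x, z) \in E.
Proof.
have [lt_arc _ out] := Egood.
have [k] := ubnP (x + y); elim: k x y => // k IHk x y xyk rxy xy.
case: (parentP y) => [[fix_y _]|py].
  have ry : root y = y by rewrite /root; apply: iter_fix.
  by move: (root_le x); rewrite rxy ry leqNgt xy.
have /andP[_ pyy] := lt_arc _ _ py.
case: (ltngtP x (parent y)) => [xp|px|/val_inj->]; last by exists y.
- have [|||z zp xz] := IHk x (parent y); rewrite ?root_parent //; first by lia.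
  by exists z => //; lia.
- have [|||z zp pz] := IHk (parent y) x; rewrite ?root_parent //; first by lia.
  by move: zp; rewrite (out _ _ _ pz py) leqNgt xy.
Qed.

Definition arc_partition : {set {set 'I_m.+1}} := preim_partition root (ground m).

Lemma arc_partitionP : finset.partition arc_partition (ground m).
Proof. exact: preim_partitionP. Qed.

Lemma arc_partition_block B x y : B \in arc_partition -> x \in B ->
  (y \in B) = (0 < y) && (root x == root y).
Proof.
case/imsetP=> z _ -> ; rewrite !finset.inE => /andP[_ /eqP->].
by [].
Qed.

Lemma std_rep_arc_partition : std_rep arc_partition = E.
Proof.
have [lt_arc _ out] := Egood.
apply/setP => -[x y]; apply/std_repP/idP => [[B BR [xB yB xy H]]|xyE].
  move: yB; rewrite (arc_partition_block _ BR xB) => /andP[y0 /eqP rxy].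
  have [z zy xz] := next_arc rxy xy.
  have /andP[x0 xltz] := lt_arc _ _ xz.
  have zB : z \in B.
    by rewrite (arc_partition_block _ BR xB) (root_arc xz) eqxx andbT; lia.
  have -> // : y = z.
  by apply/val_inj => /=; have := H _ zB xltz; lia.
have /andP[x0 xy] := lt_arc _ _ xyE.
pose B := [set c in ground m | root x == root c].
have BR : B \in arc_partition by apply/imsetP; exists x; rewrite ?finset.inE.
have xB : x \in B by rewrite !finset.inE x0 eqxx.
exists B => //; split=> //.
  by rewrite !finset.inE (root_arc xyE) eqxx andbT; lia.
move=> c; rewrite (arc_partition_block _ BR xB) => /andP[_ /eqP rxc] xc.
by have [z zc xz] := next_arc rxc xc; rewrite (out _ _ _ xyE xz).
Qed.

End Root.

(** * From partitions to arc diagrams *)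

Section Partition.
Variable R : {set {set 'I_m.+1}}.
Hypothesis Rpart : finset.partition R (ground m).

Let Rtriv : finset.trivIset R := finset.partition_trivIset Rpart.

Lemma mem_pblock_ground x : (x \in finset.pblock R x) = (0 < x).
Proof. by rewrite finset.mem_pblock (finset.cover_partition Rpart) finset.inE. Qed.

Lemma block_gt0 B x : B \in R -> x \in B -> 0 < x.
Proof.
move=> BR xB; rewrite -mem_pblock_ground.
by rewrite (finset.def_pblock Rtriv BR xB).
Qed.

Lemma std_rep_diagram : arc_diagram (std_rep R).
Proof.
split=> [x y /std_repP[B BR [xB _ xy _]]|x x' y|x y y'].
- by rewrite xy (block_gt0 BR xB).
- case/std_repP=> B BR [xB yB xy Hx] /std_repP[B' B'R [x'B' yB' x'y Hx']].
  have EB : B' = B.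
    by rewrite -(finset.def_pblock Rtriv BR yB) (finset.def_pblock Rtriv B'R yB').
  move: x'B' Hx'; rewrite {}EB => x'B Hx'; apply/val_inj => /=.
  case: (ltngtP x x') => // lt_x; first by have := Hx _ x'B lt_x; lia.
  by have := Hx' _ xB lt_x; lia.
- case/std_repP=> B BR [xB yB xy Hx] /std_repP[B' B'R [xB' y'B' xy' Hx']].
  have EB : B' = B.
    by rewrite -(finset.def_pblock Rtriv BR xB) (finset.def_pblock Rtriv B'R xB').
  move: y'B' Hx'; rewrite {}EB => y'B Hx'; apply/val_inj => /=.
  by have := Hx _ y'B xy'; have := Hx' _ yB xy; lia.
Qed.

Lemma block_arc B x y : B \in R -> x \in B -> y \in B -> x < y ->
  exists z, (z, y) \in std_rep R.
Proof.
move=> BR xB yB xy.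
have Px : (x \in B) && (x < y) by rewrite xB.
case: (arg_maxnP (P := fun z : 'I_m.+1 => (z \in B) && (z < y))
                 (fun z => val z) Px) => z /andP[zB zy] maxz.
exists z; apply/std_repP; exists B => //; split=> // c cB zc.
rewrite leqNgt; apply/negP => cy; have := maxz c; rewrite cB cy => /(_ isT) /=.
by rewrite leqNgt zc.
Qed.

Lemma pblock_arc x y : (x, y) \in std_rep R ->
  finset.pblock R x = finset.pblock R y.
Proof.
case/std_repP=> B BR [xB yB _ _].
by rewrite (finset.def_pblock Rtriv BR xB) (finset.def_pblock Rtriv BR yB).
Qed.

Lemma pblock_root x : finset.pblock R (root (std_rep R) x) = finset.pblock R x.
Proof.
suff H k : finset.pblock R (iter k (parent (std_rep R)) x) = finset.pblock R x.
  exact: H.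
elim: k => //= k <-.
by case: (parentP (std_rep R) (iter k (parent (std_rep R)) x)) => [[->]|/pblock_arc].
Qed.

(** Only the minimum of a block has no incoming arc. *)
Lemma noarc_pblock_inj x y : 0 < x -> 0 < y ->
  (forall z, (z, x) \notin std_rep R) -> (forall z, (z, y) \notin std_rep R) ->
  finset.pblock R x = finset.pblock R y -> x = y.
Proof.
move=> x0 y0 nx ny Exy.
have xB : x \in finset.pblock R x by rewrite mem_pblock_ground.
have yB : y \in finset.pblock R x by rewrite Exy mem_pblock_ground.
have BR : finset.pblock R x \in R.
  by apply: finset.pblock_mem; rewrite (finset.cover_partition Rpart) finset.inE.
apply/val_inj; case: (ltngtP (val x) (val y)) => // lt_xy.
  by have [z zy] := block_arc BR xB yB lt_xy; move: (ny z); rewrite zy.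
by have [z zx] := block_arc BR yB xB lt_xy; move: (nx z); rewrite zx.
Qed.

Lemma root_eq_pblock x y : 0 < x -> 0 < y ->
  (root (std_rep R) x == root (std_rep R) y) =
  (finset.pblock R x == finset.pblock R y).
Proof.
move=> x0 y0; apply/eqP/eqP => [Er|]; first by rewrite -pblock_root Er pblock_root.
rewrite -[finset.pblock R x]pblock_root -[finset.pblock R y]pblock_root.
have good := std_rep_diagram.
by apply: noarc_pblock_inj; rewrite ?root_gt0 // => z; rewrite root_noarc.
Qed.

Lemma arc_partition_std_rep : arc_partition (std_rep R) = R.
Proof.
rewrite -[RHS](finset.preim_partition_pblock Rpart).
apply: eq_in_imset => x; rewrite finset.inE => x0; apply/setP => y.
rewrite !finset.inE; case: (ltnP 0 y) => //= y0; exact: root_eq_pblock.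
Qed.

(** Arcs correspond to their right ends, and blocks to the points that are not right ends, namely
    their minima. *)
Lemma card_std_rep : #|std_rep R| + #|R| = m.
Proof.
have good := std_rep_diagram; have [lt_arc inj _] := good.
pose closers := [set a.2 | a in std_rep R].
have -> : #|std_rep R| = #|closers|.
  rewrite card_in_imset // => -[x y] [x' y'] /= xy xy' Ey.
  by move: xy'; rewrite -Ey => /(inj _ _ _ xy) ->.
have closersP y : reflect (exists z, (z, y) \in std_rep R) (y \in closers).
  apply: (iffP imsetP) => [[[z y'] zy ->]|[z zy]]; first by exists z.
  by exists (z, y).
have -> : R = [set finset.pblock R x | x in ground m :\: closers].
  apply/setP => B; apply/idP/imsetP => [BR|[x + ->]]; last first.
    rewrite finset.in_setD => /andP[_]; rewrite -(finset.cover_partition Rpart).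
    exact: finset.pblock_mem.
  have /set0Pn[x xB] : B != finset.set0.
    by apply: contraTneq BR => ->; case/and3P: Rpart.
  exists (root (std_rep R) x); last by rewrite pblock_root (finset.def_pblock Rtriv BR xB).
  rewrite !finset.inE root_gt0 ?(block_gt0 BR xB) // andbT.
  by apply/closersP => -[z]; apply/negP; exact: root_noarc.
rewrite [X in _ + X]card_in_imset; last first.
  move=> x y; rewrite !finset.inE => /andP[nx x0] /andP[ny y0].
  apply: noarc_pblock_inj => // z.
    by apply: contra nx => zx; apply/closersP; exists z.
  by apply: contra ny => zy; apply/closersP; exists z.
have -> : #|closers| = #|ground m :&: closers|.
  congr #|pred_of_set _|; apply/setP => y; rewrite !finset.inE.
  case: closersP => [[z /lt_arc]|]; last by rewrite andbF.
  by rewrite andbT; lia.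
rewrite cardsID (_ : ground m = [set~ ord0]) ?cardsC1 ?card_ord //.
by apply/setP => x; rewrite !finset.inE lt0n.
Qed.

End Partition.
End Arcs.

(** * The map zeta *)

Lemma height_count p i : i <= size p ->
  height p i = ((2 * count (nth false p) (iota 0 i))%:Z - i%:Z)%R.
Proof.
move=> ip; rewrite /height -(map_nth_iota0 false ip) big_map.
elim: i {ip} => [|i IHi]; first by rewrite big_nil.
rewrite -addn1 iotaD big_cat IHi count_cat big_seq1 /= addn0.
by case: (nth false p i); lia.
Qed.

Lemma std_rep_card m (R : {set {set 'I_m.+1}}) (s : seq (nat * nat)) : uniq s ->
  [seq (val a.1, val a.2) | a in std_rep R] =i s -> #|std_rep R| = size s.
Proof.
move=> us Es; rewrite -(size_image (fun a => (val a.1, val a.2))).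
apply/eqP; rewrite -uniq_size_uniq //.
by rewrite map_inj_uniq ?enum_uniq // => -[x y] [x' y'] /= [/val_inj-> /val_inj->].
Qed.

Lemma mem_std_rep_image m (R : {set {set 'I_m.+1}}) (x y : 'I_m.+1) :
  ((val x, val y) \in [seq (val a.1, val a.2) | a in std_rep R]) =
  ((x, y) \in std_rep R).
Proof.
apply/fintype.imageP/idP => [[[x' y'] xy [/val_inj-> /val_inj->]] //|xy].
by exists (x, y).
Qed.

Section Zeta.
Variable n : nat.
Implicit Types pq : (2 * n).-tuple bool * (2 * n).-tuple bool.
Local Notation P pq := (nth false pq.1).
Local Notation Q pq := (nth false pq.2).
Local Notation N := (2 * n).
Local Notation arcs pq := (pops (P pq) (Q pq) N).

Lemma noncrossing_pairsP pq :
  (pq \in noncrossing_pairs n) <->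
  [/\ never_stuck (P pq) (Q pq) N, stack (P pq) (Q pq) N = [::]
    & size (arcs pq) = n].
Proof.
rewrite finset.inE /free_dyck size_pops.
have hP i : i <= N -> height pq.1 i = ((2 * count (P pq) (iota 0 i))%:Z - i%:Z)%R.
  by move=> iN; rewrite height_count ?size_tuple.
have hQ i : i <= N -> height pq.2 i = ((2 * count (Q pq) (iota 0 i))%:Z - i%:Z)%R.
  by move=> iN; rewrite height_count ?size_tuple.
rewrite hP // hQ //; split=> [/and3P[/eqP eP /eqP eQ /forallP le_QP]|[ns s0 eQ]].
  have ns : never_stuck (P pq) (Q pq) N.
    apply: never_stuck_count => i iN.
    have := le_QP (Ordinal (n := N.+1) (m := i) iN).
    by rewrite hP //= hQ //; lia.
  have := size_stack ns (leqnn N); split=> //; last by lia.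
  by apply: size0nil; lia.
have := size_stack ns (leqnn N); rewrite s0 => /= eP.
apply/and3P; split; try lia.
apply/forallP => -[i /= iN]; rewrite hP // hQ //.
by have := size_stack ns (i := i) iN; lia.
Qed.

(** A partition is determined by its arcs, so [xget] in [vt_partition] has a single candidate. *)
Lemma zeta_eq pq R : pq \in noncrossing_pairs n ->
  finset.partition R (ground N.+1) ->
  [seq (val a.1, val a.2) | a in std_rep R] =i arcs pq -> zeta pq = R.
Proof.
case/noncrossing_pairsP=> ns s0 _ Rp RE.
have Epq : size pq.1 = size pq.2 by rewrite !size_tuple.
have Earcs : vt_arcs N.+1 (zeta_shapes pq.1 pq.2) = arcs pq.
  by have := @vt_arcs_pops pq.1 pq.2 Epq; rewrite size_tuple => ->.
apply: xget_unique => [|R' [_ R'p R'E]].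
  split=> //; last by rewrite Earcs.
  by have := @zeta_vacillating pq.1 pq.2 Epq; rewrite size_tuple => ->.
rewrite -(arc_partition_std_rep Rp) -(arc_partition_std_rep R'p).
congr arc_partition; apply/setP => -[x y].
by rewrite -!mem_std_rep_image R'E RE Earcs.
Qed.

Lemma zeta_arcs pq : pq \in noncrossing_pairs n ->
  finset.partition (zeta pq) (ground N.+1) /\
  [seq (val a.1, val a.2) | a in std_rep (zeta pq)] =i arcs pq.
Proof.
move=> pqP; have [ns _ _] := (noncrossing_pairsP pq).1 pqP.
pose E : {set 'I_N.+2 * 'I_N.+2} := [set a | (val a.1, val a.2) \in arcs pq].
have good : arc_diagram E.
  split=> [x y|x x' y|x y y']; rewrite !finset.inE.
  - by case/(pops_ltn ns) => /= -> ->.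
  - by move=> xy x'y; apply: val_inj; exact: pops_inj xy x'y.
  - by move=> xy xy'; apply: val_inj; exact: (pops_fun ns xy xy').
have imE : [seq (val a.1, val a.2) | a in std_rep (arc_partition E)] =i arcs pq.
  rewrite std_rep_arc_partition // => -[j k].
  apply/fintype.imageP/idP => [[a]|jk]; first by rewrite finset.inE => ? ->.
  have [_ jk' kN] := pops_ltn ns jk.
  have kN' : k < N.+2 by [].
  have jN : j < N.+2 by lia.
  by exists (Ordinal jN, Ordinal kN') => //; rewrite finset.inE.
by rewrite (zeta_eq pqP (arc_partitionP E) imE); split; first exact: arc_partitionP.
Qed.

Lemma zeta_noncrossing pq : pq \in noncrossing_pairs n ->
  zeta pq \in noncrossing_partitions N.+1 n.+1.
Proof.
move=> pqP; have [ns _ sz] := (noncrossing_pairsP pq).1 pqP.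
have [Rp RE] := zeta_arcs pqP; rewrite finset.inE Rp /=; apply/andP; split.
  apply/forall_inP => -[x y] xy; apply/forall_inP => -[x' y'] x'y' /=.
  by apply: (pops_noncrossing ns); rewrite -RE mem_std_rep_image.
have := card_std_rep Rp; rewrite (std_rep_card (pops_uniq _ _ _) RE) sz.
by move=> cR; apply/eqP/(@addnI n); rewrite [LHS]cR; lia.
Qed.

(** For P this relies on the empty final stack: every pushed entry is eventually popped. *)
Lemma arcs_letters pq : pq \in noncrossing_pairs n -> forall i, i < N ->
  (P pq i <-> exists k, (i.+1, k) \in arcs pq) /\
  (Q pq i <-> exists j, (j, i.+2) \in arcs pq).
Proof.
case/noncrossing_pairsP=> ns s0 _ i iN; split; split=> [Hi|[j]].
- have [] := opener_popped ns (leqnn N) iN Hi; first by rewrite s0.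
  by case=> k _; exists k.
- by move/(pops_opener ns).
- by exists (head 0 (pushed (P pq) (Q pq) i)); apply/mem_pops; exists i.
- by case/mem_pops=> i' [_ ? _ [->]].
Qed.

Lemma zeta_inj : {in noncrossing_pairs n &, injective (@zeta n)}.
Proof.
move=> pq pq' pqP pqP' Ez; have [_ RE] := zeta_arcs pqP; have [_ RE'] := zeta_arcs pqP'.
have EA a : (a \in arcs pq) = (a \in arcs pq') by rewrite -RE -RE' Ez.
have eqi i : i < N -> P pq i = P pq' i /\ Q pq i = Q pq' i.
  move=> iN; have [P1 Q1] := arcs_letters pqP iN; have [P2 Q2] := arcs_letters pqP' iN.
  split; apply/idP/idP.
  - by move/P1=> [k kA]; apply/P2; exists k; rewrite -EA.
  - by move/P2=> [k kA]; apply/P1; exists k; rewrite EA.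
  - by move/Q1=> [k kA]; apply/Q2; exists k; rewrite -EA.
  - by move/Q2=> [k kA]; apply/Q1; exists k; rewrite EA.
case: pq pq' eqi {pqP pqP' Ez RE RE' EA} => p q [p' q'] /= eqi.
congr (_, _); apply/val_inj; apply: (@eq_from_nth _ false); rewrite !size_tuple //.
  by move=> i /eqi[].
by move=> i /eqi[].
Qed.

Lemma zeta_surj R : R \in noncrossing_partitions N.+1 n.+1 ->
  exists2 pq, pq \in noncrossing_pairs n & zeta pq = R.
Proof.
rewrite finset.inE => /and3P[Rp Rnc /eqP cardR].
pose A := [seq (val a.1, val a.2) | a in std_rep R].
(* Left ends lie in [1..N] and right ends in [2..N.+1], hence the different shifts and exactly [N]
   letters in each word. *)
pose opener i := has (fun a => a.1 == i.+1) A.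
pose closer i := has (fun a => a.2 == i.+2) A.
pose p := [tuple opener i | i < N].
pose q := [tuple closer i | i < N].
have AP j k : reflect (exists x y, [/\ (x, y) \in std_rep R, j = val x & k = val y])
                      ((j, k) \in A).
  apply: (iffP fintype.imageP) => [[[x y] xy [-> ->]]|[x [y [xy -> ->]]]].
    by exists x, y.
  by exists (x, y).
have [lt_arc inj out] := std_rep_diagram Rp.
have Abound j k : (j, k) \in A -> [/\ 0 < j, j < k & k <= N.+1].
  by case/AP=> x [y [/lt_arc/andP[x0 xy] -> ->]]; split=> //; exact: (ltn_ord y).
have Ainj j j' k : (j, k) \in A -> (j', k) \in A -> j = j'.
  case/AP=> x [y [xy -> ->]] /AP[x' [y' [xy' -> /val_inj ey]]].
  by rewrite -ey in xy'; rewrite (inj _ _ _ xy xy').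
have Afun j k k' : (j, k) \in A -> (j, k') \in A -> k = k'.
  case/AP=> x [y [xy -> ->]] /AP[x' [y' [xy' /val_inj ex ->]]].
  by rewrite -ex in xy'; rewrite (out _ _ _ xy xy').
have Anc j k j' k' : (j, k) \in A -> (j', k') \in A ->
    ~~ [&& j < j', j' < k & k < k'].
  case/AP=> x [y [xy -> ->]] /AP[x' [y' [xy' -> ->]]].
  by have /forall_inP/(_ _ xy)/forall_inP/(_ _ xy') := Rnc.
have nthP (f : nat -> bool) i : i < N -> nth false [tuple f i | i < N] i = f i.
  by move=> iN; rewrite (nth_map (Ordinal iN)) ?size_enum_ord // nth_enum_ord.
have pP i : i < N -> nth false p i <-> exists k, (i.+1, k) \in A.
  move=> iN; rewrite (nthP opener) //; split=> [/hasP[[j k] jk /eqP /= <-]|[k kA]].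
    by exists k.
  by apply/hasP; exists (i.+1, k) => /=.
have qP i : i < N -> nth false q i <-> exists j, (j, i.+2) \in A.
  move=> iN; rewrite (nthP closer) //; split=> [/hasP[[j k] jk /eqP /= <-]|[j jA]].
    by exists j.
  by apply/hasP; exists (j, i.+2) => /=.
pose e j k : Prop := (j, k) \in A.
have EA : A =i arcs (p, q).
  have popsA := @noncrossing_pops _ _ _ e Abound Ainj Afun Anc pP qP.
  by move=> [j k]; apply/idP/idP => /popsA.
have pqP : (p, q) \in noncrossing_pairs n.
  apply/noncrossing_pairsP; split.
  - exact: (@noncrossing_never_stuck _ _ _ e Abound Ainj Afun Anc pP qP).
  - exact: (@noncrossing_stack_end _ _ _ e Abound Ainj Afun Anc pP qP).
  rewrite -(std_rep_card (pops_uniq _ _ _) EA).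
  by have := card_std_rep Rp; rewrite cardR; lia.
by exists (p, q) => //; apply: zeta_eq.
Qed.

End Zeta.

Theorem theorem2p4 (n : nat) (n_gt0 : 0 < n) :
  set_bij [set` noncrossing_pairs n]%classic
          [set` noncrossing_partitions (2 * n).+1 n.+1]%classic
          (@zeta n).
Proof.
split=> [pq /= pqP|pq pq' /=|R /= RP].
- exact: zeta_noncrossing.
- by rewrite !in_setE /= => pqP pqP'; exact: zeta_inj.
- by have [pq pqP <-] := zeta_surj RP; exists pq.
Qed.
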